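(* Let $\mathcal{F}$ be a periodic infinite frieze of positive integers with growth coefficients $(s_k)_{k\ge0}$. Then (1) $s_k\ge 2$ for all $k\ge0$; (2) $s_k\le s_{k+1}$ for all $k\ge0$. Furthermore, the inequalities in (2) are strict when $s_1>2$.
   Context: An infinite frieze of positive integers is an array $(m_{i,j})$, indexed by $i\in\mathbb{Z}$ and $j\ge i-2$, with $m_{i,i-2}=0$, $m_{i,i-1}=1$, with $m_{i,j}$ a positive integer for $j\ge i-1$, and with $m_{i,j}m_{i+1,j+1}-m_{i,j+1}m_{i+1,j}=1$ for all $i$ and all $j\ge i-1$. It is periodic if for some $n\ge1$ one has $m_{i+n,j+n}=m_{i,j}$ for all entries. With $n$ the minimal such period, the growth coefficients are $s_0:=2$ and $s_k:=m_{1,kn}-m_{2,kn-1}$ for $k\ge1$. *)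

(* Defs.v *)
From mathcomp Require Import all_boot all_order all_algebra.
Set Implicit Arguments.
Unset Strict Implicit.
Unset Printing Implicit Defensive.
Import Order.TTheory GRing.Theory Num.Theory.
Local Open Scope ring_scope.

(* An array indexed by pairs (i, j) with i - 2 <= j is encoded as a total
   function; the values m i j with j < i - 2 are never constrained or used. *)
Record infinite_frieze (m : int -> int -> int) : Prop := InfiniteFrieze {
  frieze_zero : forall i : int, m i (i - 2) = 0;
  frieze_one : forall i : int, m i (i - 1) = 1;
  frieze_pos : forall i j : int, i - 1 <= j -> 0 < m i j;
  frieze_diamond : forall i j : int, i - 1 <= j ->
    m i j * m (i + 1) (j + 1) - m i (j + 1) * m (i + 1) j = 1
}.

Definition is_period (m : int -> int -> int) (n : nat) : Prop :=
  (0 < n)%N /\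
  forall i j : int, i - 2 <= j -> m (i + n%:Z) (j + n%:Z) = m i j.

Definition periodic (m : int -> int -> int) : Prop :=
  exists n : nat, is_period m n.

Definition is_minimal_period (m : int -> int -> int) (n : nat) : Prop :=
  is_period m n /\ forall p : nat, is_period m p -> (n <= p)%N.

(* The case k = 0 is separate because the entry m 2 (-1) is off the array. *)
Definition growth_coef (m : int -> int -> int) (n k : nat) : int :=
  if k is 0%N then 2 else m 1 (k * n)%N%:Z - m 2 ((k * n)%N%:Z - 1).

(* Main.v *)
Require Import Defs.
From mathcomp Require Import all_boot all_order all_algebra.
From mathcomp Require Import ring lra zify.
Set Implicit Arguments.
Unset Strict Implicit.
Unset Printing Implicit Defensive.
Import Order.TTheory GRing.Theory Num.Theory.
Local Open Scope ring_scope.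

(* Every row of the frieze solves the linear recurrence
   w_(j+1) = a_(j+1) w_j - w_(j-1) whose coefficients a_j = m_(j,j) are
   n-periodic.  The monodromy matrix of this recurrence has determinant 1 and
   trace s_1, so by Cayley-Hamilton s_(k+2) = s_1 s_(k+1) - s_k, and each row
   sampled with step n satisfies the same relation.  Positivity of the first row
   forces s_1 >= 2: for s_1 <= 0 it fails at once, and for s_1 = 1 the sampled
   row satisfies x_(k+3) = - x_k.  Hence the increments s_(k+1) - s_k do not
   decrease, and the first of them is s_1 - 2 >= 0. *)

Definition second_order (R : pzRingType) (a w : nat -> R) : Prop :=
  forall j : nat, w j.+2 = a j * w j.+1 - w j.

Lemma second_order_eq (R : pzRingType) (a w z : nat -> R) :
  second_order a w -> second_order a z -> w 0%N = z 0%N -> w 1%N = z 1%N ->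
  w =1 z.
Proof.
move=> hw hz e0 e1 j.
suff [] : w j = z j /\ w j.+1 = z j.+1 by [].
by elim: j => [//|j [IH0 IH1]]; split=> //; rewrite hw hz IH0 IH1.
Qed.

Section Monodromy.

Variables (R : comPzRingType) (a U V : nat -> R) (n : nat).
Hypotheses (aP : forall j, a (j + n)%N = a j).
Hypotheses (hU : second_order a U) (hV : second_order a V).
Hypotheses (U0 : U 0%N = 0) (U1 : U 1%N = 1).
Hypotheses (V0 : V 0%N = -1) (V1 : V 1%N = 0).

Lemma wronskian_eq1 (j : nat) : U j * V j.+1 - U j.+1 * V j = 1.
Proof.
elim: j => [|j <-]; first by rewrite U0 U1 V0 V1; ring.
by rewrite hU hV; ring.
Qed.

(** Since [U] and [-V] start with (0, 1) and (1, 0), a solution has its first two values as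
    coordinates in them; periodicity of [a] makes the shifted [w] a solution. *)
Lemma second_order_shift (w : nat -> R) (j : nat) : second_order a w ->
  w (j + n)%N = w n.+1 * U j - w n * V j.
Proof.
move=> hw; apply: (@second_order_eq _ a (fun j => w (j + n)%N)
  (fun j => w n.+1 * U j - w n * V j)); rewrite /second_order.
- by move=> i; rewrite !addSn hw aP.
- by move=> i; rewrite hU hV; ring.
- by rewrite add0n U0 V0; ring.
- by rewrite add1n U1 V1; ring.
Qed.

Lemma second_order_cayley_hamilton (j : nat) (s := U n.+1 - V n) :
  U (j + n + n)%N = s * U (j + n)%N - U j /\
  V (j + n + n)%N = s * V (j + n)%N - V j.
Proof.
have W := wronskian_eq1 n; have E := second_order_shift _ hU.
have F := second_order_shift _ hV.
rewrite (E (j + n)%N) (F (j + n)%N) !E !F /s.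
(* In the basis [U], [V] the shift by [n] has trace [s] and the Wronskian as determinant;
   substituting the latter for 1 leaves a polynomial identity. *)
by split; rewrite -[X in _ = _ - X]mul1r -W; ring.
Qed.

End Monodromy.

Section Chebyshev.

Variables (s : int) (x : nat -> int).
Hypothesis xE : forall k, x k.+2 = s * x k.+1 - x k.

Lemma chebyshev_pos_ge2 : (forall k, 0 < x k) -> 2 <= s.
Proof.
move=> xP; rewrite leNgt; apply/negP => s2.
have [p0 p1 p2 p3] := And4 (xP 0%N) (xP 1%N) (xP 2%N) (xP 3%N).
have e2 := xE 0; have e3 := xE 1.
have [s1|s0] : s = 1 \/ s <= 0 by lia.
  by move: e2 e3; rewrite s1 !mul1r; lia.
by have := mulr_le0_ge0 s0 (ltW p1); lia.
Qed.

Lemma chebyshev_increment : 2 <= s -> x 0%N = 2 -> x 1%N = s ->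
  forall k, s - 2 <= x k.+1 - x k /\ 2 <= x k.
Proof.
move=> s2 x0 x1; elim=> [|k [IH1 IH2]]; first by rewrite x0 x1.
have p : 2 <= x k.+1 by lia.
split=> //; rewrite xE.
(* This product is the amount by which the next increment exceeds the current one. *)
have : 0 <= (s - 2) * x k.+1 by apply: mulr_ge0; lia.
by rewrite mulrBl; lia.
Qed.

End Chebyshev.

Lemma frieze_row_recurrence (m : int -> int -> int) (i j : int) :
  infinite_frieze m -> i - 1 <= j ->
  m i (j + 1) = m (j + 1) (j + 1) * m i j - m i (j - 1).
Proof.
case=> m0 m1 mP mD ij.
have [d di] : exists d : nat, i = j + 1 - d%:Z by exists `|(j + 1 - i)%R|%N; lia.
elim: d i di {ij} => [|d IH] i di.
  have -> : j = i - 1 by lia.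
  have -> : i - 1 - 1 = i - 2 by lia.
  by rewrite subrK m0 m1 mulr1 subr0.
have /IH v2 : i + 1 = j + 1 - d%:Z by lia.
have vP : 0 < m (i + 1) j by apply: mP; lia.
have d1 : i - 1 <= j by lia.
have d0 : i - 1 <= j - 1 by lia.
(* With row [i + 1] already known to satisfy the recurrence, the difference of two adjacent diamonds
   is the claim times [m (i + 1) j]. *)
move: (mD _ _ d1) (mD _ _ d0); rewrite subrK v2 => e1 e0.
by apply: (mulIf (lt0r_neq0 vP)); lra.
Qed.

Theorem lemma4p3 (m : int -> int -> int) (hF : infinite_frieze m)
    (hP : periodic m) (n : nat) (hn : is_minimal_period m n) :
  [/\ forall k : nat, 2 <= growth_coef m n k,
      forall k : nat, growth_coef m n k <= growth_coef m n k.+1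
    & 2 < growth_coef m n 1 ->
      forall k : nat, growth_coef m n k < growth_coef m n k.+1].
Proof.
case: hn => -[n0 nP] _; case: (hF) => m0 m1 mP _.
pose a j := m (j%:Z + 1) (j%:Z + 1).
pose U j := m 1 (j%:Z - 1).
(* The value -1 extends row 2 one step to the left of the array, where the
   recurrence forces it; it makes U (k * n).+1 - V (k * n) equal s_k even at
   k = 0. *)
pose V j := if j is 0%N then -1 else m 2 (j%:Z - 1).
have U0 : U 0%N = 0 by exact: (m0 1).
have U1 : U 1%N = 1 by exact: (m1 1).
have V1 : V 1%N = 0 by exact: (m0 2).
have hU : second_order a U.
  move=> j; rewrite /U /a.
  have -> : j.+2%:Z - 1 = j%:Z + 1 by lia.
  have -> : j.+1%:Z - 1 = j%:Z by lia.
  by apply: frieze_row_recurrence => //; lia.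
have hV : second_order a V.
  case=> [|j]; first by rewrite V1 mulr0 sub0r opprK; exact: (m1 2).
  rewrite /V /a.
  have -> : j.+3%:Z - 1 = j.+1%:Z + 1 by lia.
  have -> : j.+2%:Z - 1 = j.+1%:Z by lia.
  by apply: frieze_row_recurrence => //; lia.
have aP j : a (j + n)%N = a j.
  rewrite /a; have -> : (j + n)%N%:Z + 1 = j%:Z + 1 + n%:Z by lia.
  by apply: nP; lia.
have sE k : growth_coef m n k = U (k * n).+1 - V (k * n)%N.
  case: k => [|k]; first by rewrite mul0n U1.
  rewrite /growth_coef /U.
  have -> : (k.+1 * n).+1%:Z - 1 = (k.+1 * n)%N%:Z by lia.
  by rewrite /V; case E : (k.+1 * n)%N => [|p] //; lia.
set s := growth_coef m n 1.
have CH j : U (j + n + n)%N = s * U (j + n)%N - U j /\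
            V (j + n + n)%N = s * V (j + n)%N - V j.
  rewrite /s sE mul1n.
  exact: second_order_cayley_hamilton.
have kS k : (k.+1 * n = k * n + n)%N by rewrite mulSn addnC.
have s2 : 2 <= s.
  (* The offset 1 avoids the zero entry [U 0]: the samples are the positive entries
     [m 1 (k * n)]. *)
  apply: (@chebyshev_pos_ge2 s (fun k => U (k * n).+1)) => k.
    by rewrite !kS -!addSn; case: (CH (k * n).+1).
  by apply: mP; lia.
have rec k : growth_coef m n k.+2 =
    s * growth_coef m n k.+1 - growth_coef m n k.
  rewrite !sE !kS -!addSn.
  by have [-> _] := CH (k * n).+1; have [_ ->] := CH (k * n)%N; ring.
have inc := chebyshev_increment rec s2 erefl erefl.
split=> [k|k|s3 k]; have [h1 h2] := inc k => //; lia.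
Qed.
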